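(* Let $p^0,n^0,\rho^f\in\mathcal{C}$ be real grid functions with $\langle p^0-n^0+\rho^f,1\rangle_h=0$, let $\epsilon>0$, and let $\tau>0$ be arbitrary. Let $(p^k,n^k,\phi^k)_{k\ge 0}$ be the solution of the ETD1 scheme with time step $\tau$. If $p^0\ge 0$ and $n^0\ge 0$ (entrywise), then for every $k\ge0$, $$p^k\ge 0\quad\text{and}\quad n^k\ge 0\quad\text{(entrywise)}.$$
   Context: Let $L>0$, $N\in\mathbb{Z}^+$, $h=L/N$. $\mathcal{C}$ denotes the space of real grid functions $u=(u_{i,j})_{i,j\in\mathbb{Z}}$ that are $N$-periodic in each index (an $N^2$-dimensional space). The discrete inner product is $\langle u,v\rangle_h=h^2\sum_{i,j=1}^N u_{i,j}v_{i,j}$, and $1$ denotes the constant grid function. The discrete Laplacian is $(\Delta_h u)_{i,j}=\frac1{h^2}(u_{i+1,j}+u_{i-1,j}+u_{i,j+1}+u_{i,j-1}-4u_{i,j})$. For $f\in\mathcal{C}$ with $\langle f,1\rangle_h=0$, $(-\epsilon^2\Delta_h)^{-1}f$ denotes the unique $\phi\in\mathcal{C}$ with $-\epsilon^2\Delta_h\phi=f$ and $\langle\phi,1\rangle_h=0$. For $\phi\in\mathcal{C}$, the linear operator $\mathcal{L}_h[\phi]:\mathcal{C}\to\mathcal{C}$ is $$(\mathcal{L}_h[\phi]u)_{i,j}=\frac1{h^2}\sum_{(i',j')}\frac{2e^{\phi_{i',j'}}e^{\phi_{i,j}}}{e^{\phi_{i',j'}}+e^{\phi_{i,j}}}\left(\frac{u_{i',j'}}{e^{\phi_{i',j'}}}-\frac{u_{i,j}}{e^{\phi_{i,j}}}\right),$$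 the sum being over the four neighbours $(i',j')\in\{(i+1,j),(i-1,j),(i,j+1),(i,j-1)\}$. It discretizes $\nabla\cdot(e^{\phi}\nabla(u/e^{\phi}))$. ETD1 scheme (first-order exponential time differencing scheme for the Poisson–Nernst–Planck equations): given $p^0,n^0$, set $\phi^0=(-\epsilon^2\Delta_h)^{-1}(p^0-n^0+\rho^f)$, and for $k\ge0$ $$p^{k+1}=e^{\tau\mathcal{L}_h[-\phi^k]}p^k,\qquad n^{k+1}=e^{\tau\mathcal{L}_h[\phi^k]}n^k,\qquad \phi^{k+1}=(-\epsilon^2\Delta_h)^{-1}(p^{k+1}-n^{k+1}+\rho^f),$$ where $e^{(\cdot)}$ of an operator is the operator exponential. The scheme is well defined because $p^k-n^k+\rho^f$ has zero mean for every $k$. *)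

(* Defs.v *)
From HB Require Import structures.
From mathcomp Require Import all_boot all_order all_algebra.
From mathcomp Require Import all_classical all_reals all_analysis.

Set Implicit Arguments.
Unset Strict Implicit.
Unset Printing Implicit Defensive.

Import Order.TTheory GRing.Theory Num.Theory.
Import numFieldNormedType.Exports.

Local Open Scope classical_set_scope.
Local Open Scope ring_scope.

Notation grid R := (int -> int -> R).

Definition grid_periodic (R : realType) (N : nat) (u : grid R) : Prop :=
  forall i j : int, u (i + N%:Z) j = u i j /\ u i (j + N%:Z) = u i j.

Definition inner_h (R : realType) (h : R) (N : nat) (u v : grid R) : R :=
  h ^+ 2 * \sum_(1 <= i < N.+1) \sum_(1 <= j < N.+1) u i%:Z j%:Z * v i%:Z j%:Z.

Definition one_h (R : realType) : grid R := fun _ _ => 1.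

Definition laplace_h (R : realType) (h : R) (u : grid R) : grid R :=
  fun i j => (h ^+ 2)^-1 *
    (u (i + 1) j + u (i - 1) j + u i (j + 1) + u i (j - 1) - 4 * u i j).

(* phi = (- eps^2 Delta_h)^-1 f, for f of zero mean: the inverse is given by its
   graph, namely phi is the zero-mean periodic solution of the linear system. *)
Definition poisson_h (R : realType) (h : R) (N : nat) (eps : R)
    (f phi : grid R) : Prop :=
  [/\ grid_periodic N phi,
      (forall i j : int, - (eps ^+ 2 * laplace_h h phi i j) = f i j)
    & inner_h h N phi (one_h R) = 0].

Definition neighbours (i j : int) : seq (int * int) :=
  [:: (i + 1, j); (i - 1, j); (i, j + 1); (i, j - 1)].

(* The neighbours are taken in Z^2, so that for N = 1, 2 those which coincide
   modulo N are counted with multiplicity. *)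
Definition L_h (R : realType) (h : R) (phi : grid R) (u : grid R) : grid R :=
  fun i j => (h ^+ 2)^-1 * \sum_(q <- neighbours i j)
    2 * expR (phi q.1 q.2) * expR (phi i j)
      / (expR (phi q.1 q.2) + expR (phi i j))
    * (u q.1 q.2 / expR (phi q.1 q.2) - u i j / expR (phi i j)).

(* The operator exponential \sum_m A^m / m!, evaluated at u. The periodic grid
   functions form a finite-dimensional space, so for A a linear operator on it
   the series converges, and entrywise convergence is convergence in norm. *)
Definition op_exp (R : realType) (A : grid R -> grid R) (u : grid R) : grid R :=
  fun i j => limn (series (fun m : nat => iter m A u i j / (m`!)%:R)).

Record ETD1 (R : realType) (h : R) (N : nat) (eps tau : R)
    (p0 n0 rhof : grid R) (p n phi : nat -> grid R) : Prop := {
  ETD1_p0 : p 0%N = p0;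
  ETD1_n0 : n 0%N = n0;
  ETD1_phi : forall k : nat, poisson_h h N eps (p k - n k + rhof) (phi k);
  ETD1_p : forall k : nat, p k.+1 = op_exp (tau *: L_h h (- phi k)) (p k);
  ETD1_n : forall k : nat, n k.+1 = op_exp (tau *: L_h h (phi k)) (n k)
}.

(* Main.v *)
Require Import Defs.
From HB Require Import structures.
From mathcomp Require Import all_boot all_order all_algebra.
From mathcomp Require Import all_classical all_reals all_analysis.
From mathcomp Require Import ring lra.

Set Implicit Arguments.
Unset Strict Implicit.
Unset Printing Implicit Defensive.

Import Order.TTheory GRing.Theory Num.Theory.
Import numFieldNormedType.Exports.

Local Open Scope classical_set_scope.
Local Open Scope ring_scope.

(* On bounded grid functions L_h is bounded, whatever phi is, and with
   c = 8 / h^2 the operator L_h + c has nonnegative coefficients, since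
   2 e^a / (e^a + e^b) <= 2 for each of the four neighbours.  Hence
   e^(tau L_h) = e^(- tau c) e^(tau (L_h + c)) preserves nonnegativity and
   boundedness, the latter being inherited from the periodic initial data. *)

(** * Cauchy products with the exponential series *)

Lemma exp_coeff_convolution (R : realType) (c d : R) (m : nat) :
  \sum_(k < m.+1) exp_coeff c (m - k)%N * exp_coeff d k = exp_coeff (c + d) m.
Proof.
rewrite /exp_coeff /= exprDn mulr_suml; apply: eq_bigr => k _.
have km : (k <= m)%N by rewrite -ltnS.
have fact_neq0 (j : nat) : (j`!%:R : R) != 0 by rewrite pnatr_eq0 -lt0n fact_gt0.
have bin_neq0 : ('C(m, k)%:R : R) != 0 by rewrite pnatr_eq0 -lt0n bin_gt0.
rewrite -[_ *+ _]mulr_natr -(bin_fact km) !natrM.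
by field; rewrite bin_neq0 !fact_neq0.
Qed.

(** Summation over the triangle [k <= m < n] with [k] outermost: the inner index [m - k] then runs
    over the [n - k] values below [n - k]. *)
Lemma series_convolution (R : realType) (x y : R ^nat) (n : nat) :
  \sum_(m < n) \sum_(k < m.+1) x (m - k)%N * y k =
  \sum_(k < n) series x (n - k)%N * y k.
Proof.
elim: n => [|n IHn]; first by rewrite !big_ord0.
rewrite big_ord_recr /= IHn [in RHS]big_ord_recr /= subSnn.
rewrite [X in _ + X]big_ord_recr /= subnn [in LHS]addrA -big_split /=.
congr (_ + _); last by rewrite /series /= big_nat1.
apply: eq_bigr => k _; rewrite -mulrDl subSn ?(ltnW (ltn_ord k)) //.
by congr (_ * _); rewrite [RHS]big_nat_recr.
Qed.

Lemma cvg_series_le_exp_coeff (R : realType) (K M : R) (y : R ^nat) :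
  (forall k, `|y k| <= M * exp_coeff K k) -> cvgn [normed series y].
Proof.
move=> yM; apply: (@series_le_cvg _ _ (fun k => M * exp_coeff K k)) => [k|k|k|].
- exact: normr_ge0.
- exact: le_trans (yM k).
- exact: yM.
- by apply: is_cvg_seriesZ; apply: is_cvg_series_exp_coeff.
Qed.

(* Partial sums of the Cauchy product and products of partial sums differ by at
   most M times the same difference for the series of e^c and e^K, which tends
   to 0 since e^c e^K = e^(c + K). *)
Lemma limn_series_ge0 (R : realType) (c K M : R) (y : R ^nat) :
  0 <= c -> (forall k, `|y k| <= M * exp_coeff K k) ->
  (forall m, 0 <= \sum_(k < m.+1) exp_coeff c (m - k)%N * y k) ->
  0 <= limn (series y).
Proof.
move=> c0 yM conv_ge0; set e := @exp_coeff R.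
have cvg_y : cvgn (series y) by apply: normed_cvg; apply: cvg_series_le_exp_coeff yM.
have cvg_e x : series (e x) @ \oo --> expR x := is_cvg_series_exp_coeff x.
have serE (x : R ^nat) n : series x n = \sum_(k < n) x k.
  by rewrite /series /= big_mkord.
pose gap n := M * (series (e c) n * series (e K) n - series (e (c + K)) n).
have cvg_gap : gap @ \oo --> 0.
  rewrite -(mulr0 M) -(subrr (expR (c + K))) {1}expRD.
  by apply: cvgMl_tmp; apply: cvgB; [apply: cvgM|].
have gapE n : gap n =
    \sum_(k < n) (series (e c) n - series (e c) (n - k)%N) * (M * e K k).
  transitivity (\sum_(k < n) series (e c) n * (M * e K k) -
                \sum_(k < n) series (e c) (n - k)%N * (M * e K k)).
    rewrite /gap mulrBr; congr (_ - _).
      by rewrite mulrCA [series (e K) n]serE !mulr_sumr.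
    rewrite -(series_convolution (e c) (fun k => M * e K k)) serE mulr_sumr.
    apply: eq_bigr => m _; rewrite {1}/e -exp_coeff_convolution mulr_sumr.
    by apply: eq_bigr => k _; rewrite mulrCA.
  by rewrite -sumrB; apply: eq_bigr => k _; rewrite mulrBl.
(* [E] is a partial sum of the Cauchy product, hence nonnegative. Replacing [y k] by its lower bound
   [- (M * e K k)] in the difference from [E] gives [- gap n], because the weights there are
   nonnegative: partial sums of [e c] increase. *)
have gap_le n : - gap n <= series (e c) n * series y n.
  pose E := \sum_(k < n) series (e c) (n - k)%N * y k.
  have E_ge0 : 0 <= E by rewrite /E -series_convolution sumr_ge0.
  suff: - gap n <= series (e c) n * series y n - E.
    by move=> /le_trans; apply; rewrite gerBl.
  rewrite [series y n]serE mulr_sumr /E -sumrB gapE -sumrN.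
  apply: ler_sum => k _; rewrite -mulrBl -mulrN ler_wpM2l //.
    rewrite subr_ge0; apply: nondecreasing_series => [m _ _|]; last exact: leq_subr.
    exact: exp_coeff_ge0.
  by rewrite lerNl (le_trans _ (yM k)) // -normrN ler_norm.
(* The factor [expR c] is positive, so the sign can be read off the limit of the product, which is
   bounded below by [- gap]. *)
rewrite -(pmulr_rge0 _ (expR_gt0 c)).
have cvg_ngap : (- gap) @ \oo --> 0 by have := cvgN cvg_gap; rewrite oppr0; exact.
have cvg_prod : series (e c) * series y @ \oo --> expR c * limn (series y).
  exact: cvgM.
by apply: (ler_cvg_to cvg_ngap cvg_prod); near=> n; exact: gap_le.
Unshelve. all: by end_near. Qed.

(** * Exponential of an operator bounded in the sup norm *)

Section Exponential.
Variables (R : realType) (A : {linear grid R -> grid R}) (K : R).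
Hypothesis A_bounded : forall (u : grid R) (M : R),
  (forall i j, `|u i j| <= M) -> forall i j, `|A u i j| <= K * M.

Lemma iter_bounded (u : grid R) (M : R) (m : nat) :
  (forall i j, `|u i j| <= M) ->
  forall i j, `|iter m A u i j| <= M * K ^+ m.
Proof.
move=> uM; elim: m => [|m IHm] i j /=; first by rewrite expr0 mulr1.
by rewrite exprS mulrCA; apply: A_bounded.
Qed.

Lemma op_exp_coeff_bounded (u : grid R) (M : R) (i j : int) :
  (forall i j, `|u i j| <= M) ->
  forall m, `|iter m A u i j / m`!%:R| <= M * exp_coeff K m.
Proof.
move=> uM m; rewrite normrM normfV normr_nat /exp_coeff /= mulrA.
by rewrite ler_wpM2r ?invr_ge0 //; apply: iter_bounded.
Qed.

Lemma op_exp_bounded (u : grid R) (M : R) :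
  (forall i j, `|u i j| <= M) ->
  forall i j, `|op_exp A u i j| <= M * expR K.
Proof.
move=> uM i j; have coeffM := op_exp_coeff_bounded i j uM.
have cvg_norm := cvg_series_le_exp_coeff coeffM.
apply: le_trans (lim_series_norm cvg_norm) _.
rewrite /expR -[_ * _](lim_seriesZ _ (is_cvg_series_exp_coeff K)).
apply: lim_series_le => //.
by apply: is_cvg_seriesZ; apply: is_cvg_series_exp_coeff.
Qed.

(** This is [(A + c)^m u / m!], expanded as the degree [m] term of the Cauchy product of the series
    of [e^c] and [e^A u]. *)
Definition op_convolution (c : R) (u : grid R) (m : nat) : grid R :=
  \sum_(k < m.+1) exp_coeff c (m - k)%N *: ((k`!%:R)^-1 *: iter k A u).

(** The recurrence of [(A + c)^m / m!], through which positivity of [A + c] passes from one degree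
    to the next. *)
Lemma op_convolutionS (c : R) (u : grid R) (m : nat) :
  m.+1%:R *: op_convolution c u m.+1 =
  A (op_convolution c u m) + c *: op_convolution c u m.
Proof.
have fact_neq0 (j : nat) : (j`!%:R : R) != 0 by rewrite pnatr_eq0 -lt0n fact_gt0.
have succ_neq0 (j : nat) : (j.+1%:R : R) != 0 by rewrite pnatr_eq0.
rewrite /op_convolution [A _]linear_sum !scaler_sumr.
pose F k := exp_coeff c (m.+1 - k)%N *: ((k`!%:R)^-1 *: iter k A u).
(* Split the weight [m + 1 = k + (m + 1 - k)]. The factor [k] cancels against [k!] and releases one
   [A]; the factor [m + 1 - k] cancels against its factorial and releases one [c]. The terms [k = 0]
   and [k = m + 1] drop out respectively. *)
transitivity (\sum_(k < m.+2) (k%:R *: F k + (m.+1 - k)%:R *: F k)).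
  apply: eq_bigr => k _; rewrite -scalerDl -natrD subnKC //.
  by rewrite -ltnS.
rewrite big_split /=; congr (_ + _).
  rewrite big_ord_recl scale0r add0r; apply: eq_bigr => k _.
  rewrite lift0 /F subSS !linearZ /= !scalerA; congr (_ *: _).
  move: (succ_neq0 k); rewrite factS natrM.
  by move: k.+1%:R => a a_neq0; field; rewrite a_neq0 fact_neq0.
rewrite big_ord_recr /= subnn scale0r addr0; apply: eq_bigr => k _.
rewrite /F subSn; last by rewrite -ltnS.
rewrite !scalerA; congr (_ * _ *: _); rewrite /exp_coeff /= factS natrM exprS.
move: (succ_neq0 (m - k)%N); move: (m - k).+1%:R => a a_neq0.
by field; rewrite a_neq0 fact_neq0.
Qed.

(* If A + c preserves nonnegativity then so does exp A = e^(-c) exp (A + c). *)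
Lemma op_exp_ge0 (c M : R) (u : grid R) :
  0 <= c ->
  (forall v : grid R, (forall i j, 0 <= v i j) ->
    forall i j, 0 <= A v i j + c * v i j) ->
  (forall i j, `|u i j| <= M) -> (forall i j, 0 <= u i j) ->
  forall i j, 0 <= op_exp A u i j.
Proof.
move=> c0 Ac_ge0 uM u_ge0 i j.
have conv_ge0 m : forall i j, 0 <= op_convolution c u m i j.
  elim: m => [|m IHm] i' j'.
    rewrite /op_convolution big_ord1 /exp_coeff /= fact0 divr1 invr1 !scale1r.
    exact: u_ge0.
  rewrite -(pmulr_rge0 _ (ltr0Sn R m)).
  have := Ac_ge0 _ IHm i' j'.
  by rewrite -[X in 0 <= X]/((_ + _ *: _) i' j') -op_convolutionS.
apply: (limn_series_ge0 c0 (op_exp_coeff_bounded i j uM)) => m.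
have := conv_ge0 m i j; rewrite /op_convolution !fct_sumE.
congr (0 <= _); apply: eq_bigr => k _ /=.
by rewrite -[LHS]/(_ * (_ * _)) (mulrC _^-1).
Qed.

End Exponential.

(** * Bounds on [L_h] uniform in [phi] *)

Section DriftDiffusion.
Variables (R : realType) (h : R) (phi : grid R).

Lemma scaled_L_h_linear (tau : R) : linear (tau *: L_h h phi).
Proof.
move=> a u v; apply/funext => i; apply/funext => j.
rewrite -[LHS]/(tau * _) -[RHS]/(a * (tau * _) + tau * _) /L_h /=.
rewrite !big_cons !big_nil /= !addr0.
have E k l : (a *: u + v) k l = a * u k l + v k l by [].
rewrite !E.
ring.
Qed.

Let harmonic_mean_div (a b : R) : 0 < a -> 0 < b ->
  0 <= 2 * a * b / (a + b) / a <= 2.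
Proof.
move=> a0 b0; have ab0 : 0 < a + b by rewrite addr_gt0.
have -> : 2 * a * b / (a + b) / a = 2 * (b / (a + b)).
  by field; rewrite !gt_eqF.
rewrite mulr_ge0 ?divr_ge0 ?(ltW b0) ?(ltW ab0) //=.
by rewrite -[leRHS]mulr1 ler_wpM2l // ler_pdivrMr // mul1r lerDr ltW.
Qed.

(** Separates the neighbour coefficients from the diagonal one. Each is a harmonic mean divided by
    one of its arguments, of the form [2 b / (a + b)], so the bounds do not depend on [phi]; the
    diagonal collects four of them, whence 8. *)
Lemma L_h_decomposition (i j : int) :
  exists a : int * int -> R, exists b : R,
   [/\ forall q, 0 <= a q <= 2, 0 <= b <= 8 & forall u : grid R,
     L_h h phi u i j =
       (h ^+ 2)^-1 * (\sum_(q <- neighbours i j) a q * u q.1 q.2 - b * u i j)].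
Proof.
pose e (k l : int) := expR (phi k l).
pose w q := 2 * e q.1 q.2 * e i j / (e q.1 q.2 + e i j).
have bnd q : 0 <= w q / e i j <= 2.
  (* The harmonic mean is symmetric; exchanging its arguments gives the bound after division by the
     central value. *)
  rewrite /w (mulrAC 2) (addrC (e _ _)).
  by apply: harmonic_mean_div; exact: expR_gt0.
exists (fun q => w q / e q.1 q.2).
exists (\sum_(q <- neighbours i j) w q / e i j); split => [q||u].
- by apply: harmonic_mean_div; exact: expR_gt0.
- rewrite /neighbours !big_cons big_nil addr0.
  have [] := (bnd (i + 1, j), bnd (i - 1, j)).
  have [] := (bnd (i, j + 1), bnd (i, j - 1)).
  by lra.
- rewrite /L_h -/(e i j) mulr_suml -sumrB; congr (_ * _).
  by apply: eq_bigr => q _; rewrite /w /e; ring.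
Qed.

Lemma scaled_L_h_bounded (tau : R) : 0 <= tau -> forall (u : grid R) (M : R),
  (forall i j, `|u i j| <= M) ->
  forall i j, `|(tau *: L_h h phi) u i j| <= 16 * (tau * (h ^+ 2)^-1) * M.
Proof.
move=> tau0 u M uM i j; have [a [b [a_bnd b_bnd LE]]] := L_h_decomposition i j.
have M0 : 0 <= M := le_trans (normr_ge0 _) (uM 0 0).
have h0 : 0 <= (h ^+ 2)^-1 by rewrite invr_ge0 sqr_ge0.
rewrite -[(_ *: _) _ _ _]/(tau * _) LE [X in `|X|]mulrA normrM (ger0_norm (mulr_ge0 tau0 h0)).
rewrite [leRHS]mulrAC [leRHS]mulrC ler_wpM2l ?mulr_ge0 //.
apply: le_trans (ler_normB _ _) _.
have term c v (d : R) : 0 <= c <= d -> `|v| <= M -> `|c * v| <= d * M.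
  move=> /andP[c0 cd] vM; rewrite normrM (ger0_norm c0).
  by apply: ler_pM.
(* Four neighbours with coefficient at most 2, and the diagonal with at most 8. *)
have -> : 16 * M = 4 * (2 * M) + 8 * M by ring.
apply: lerD; last exact: term.
apply: le_trans (ler_norm_sum _ _ _) _.
rewrite /neighbours !big_cons big_nil addr0.
have t q := term _ _ _ (a_bnd q) (uM q.1 q.2).
have -> : 4 * (2 * M) = 2 * M + (2 * M + (2 * M + 2 * M)) by ring.
by rewrite !lerD // t.
Qed.

(** Only the diagonal coefficient [- b] is negative, and the shift by 8 absorbs it. *)
Lemma scaled_L_h_shift_ge0 (tau : R) : 0 <= tau ->
  forall u : grid R, (forall i j, 0 <= u i j) ->
  forall i j, 0 <= (tau *: L_h h phi) u i j + 8 * (tau * (h ^+ 2)^-1) * u i j.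
Proof.
move=> tau0 u u0 i j; have [a [b [a_bnd /andP[_ b8] LE]]] := L_h_decomposition i j.
have h0 : 0 <= (h ^+ 2)^-1 by rewrite invr_ge0 sqr_ge0.
rewrite -[(_ *: _) _ _ _]/(tau * _) LE.
set s := \sum_(q <- _) _.
have -> : tau * ((h ^+ 2)^-1 * (s - b * u i j)) + 8 * (tau * (h ^+ 2)^-1) * u i j =
   tau * (h ^+ 2)^-1 * (s + (8 - b) * u i j) by ring.
rewrite mulr_ge0 ?mulr_ge0 // addr_ge0 //; last by rewrite mulr_ge0 // subr_ge0.
by apply: sumr_ge0 => q _; rewrite mulr_ge0 //; case/andP: (a_bnd q).
Qed.

(** The invariant of the time stepping: boundedness makes the exponential series converge, and it is
    inherited by the next iterate. *)
Definition bounded_nonneg (u : grid R) : Prop :=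
  (exists M : R, forall i j, `|u i j| <= M) /\ (forall i j, 0 <= u i j).

Lemma op_exp_L_h_bounded_nonneg (tau : R) (u : grid R) : 0 <= tau ->
  bounded_nonneg u -> bounded_nonneg (op_exp (tau *: L_h h phi) u).
Proof.
move=> tau0 [[M uM] u0].
pose A : {linear grid R -> grid R} := HB.pack (tau *: L_h h phi)
  (GRing.isLinear.Build R (grid R) (grid R) _ _ (scaled_L_h_linear tau)).
have bnd := scaled_L_h_bounded tau0.
split.
  exists (M * expR (16 * (tau * (h ^+ 2)^-1))) => i j.
  exact: (op_exp_bounded (A := A) bnd uM).
apply: (op_exp_ge0 (A := A) bnd _ (scaled_L_h_shift_ge0 tau0) uM u0).
by rewrite !mulr_ge0 // invr_ge0 sqr_ge0.
Qed.

End DriftDiffusion.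

(** * Periodic initial data and induction on time steps *)

Lemma periodic_bounded (R : realType) (N : nat) (u : grid R) :
  (0 < N)%N -> grid_periodic N u -> exists M : R, forall i j, `|u i j| <= M.
Proof.
move=> N0 u_per; pose mN (i : int) := (i %% N%:Z)%Z.
have shift (f : int -> R) : (forall i, f (i + N%:Z) = f i) ->
    forall i, f i = f (mN i).
  move=> f_per i; rewrite {1}(divz_eq i N%:Z) addrC; set r := (_ %% _)%Z.
  have fM (m : nat) k : f (k + m%:Z * N%:Z) = f k.
    elim: m => [|m IHm]; first by rewrite mul0r addr0.
    by rewrite -addn1 PoszD mulrDl mul1r addrA f_per IHm.
  (* For a negative quotient, [fM] is used backwards: adding the multiple of the period returns to
     the remainder. *)
  case: (_ %/ _)%Z => m; first exact: fM.
  by rewrite NegzE -(fM m.+1) -addrA -mulrDl addNr mul0r addr0.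
have mN_lt i : (`|mN i| < N)%N /\ mN i = `|mN i|%N.
  have mi0 : 0 <= mN i by apply: modz_ge0; rewrite eqz_nat -lt0n.
  split; last by rewrite gez0_abs.
  by rewrite -ltz_nat gez0_abs // ltz_pmod.
(* The sum of absolute values over one period cell dominates each of its terms. *)
exists (\sum_(k < N) \sum_(l < N) `|u k%:Z l%:Z|) => i j.
rewrite (shift (u i)) => [|j']; last by case: (u_per i j').
rewrite (shift (u^~ (mN j))) => [|i']; last by case: (u_per i' (mN j)).
have [[iN ->] [jN ->]] := (mN_lt i, mN_lt j).
rewrite (bigD1 (Ordinal iN)) //= (bigD1 (Ordinal jN)) //= -addrA lerDl.
by rewrite addr_ge0 ?sumr_ge0 // => k _; rewrite sumr_ge0.
Qed.

Theorem theorem2 (R : realType) (L : R) (N : nat) (hL : 0 < L) (hN : (0 < N)%N)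
    (p0 n0 rhof : grid R)
    (p0_periodic : grid_periodic N p0) (n0_periodic : grid_periodic N n0)
    (rhof_periodic : grid_periodic N rhof)
    (zero_mean : inner_h (L / N%:R) N (p0 - n0 + rhof) (one_h R) = 0)
    (eps tau : R) (heps : 0 < eps) (htau : 0 < tau)
    (p n phi : nat -> grid R)
    (scheme : ETD1 (L / N%:R) N eps tau p0 n0 rhof p n phi)
    (p0_ge0 : forall i j : int, 0 <= p0 i j)
    (n0_ge0 : forall i j : int, 0 <= n0 i j) :
  forall k : nat,
    (forall i j : int, 0 <= p k i j) /\ (forall i j : int, 0 <= n k i j).
Proof.
have inv k : bounded_nonneg (p k) /\ bounded_nonneg (n k).
  elim: k => [|k [IHp IHn]].
    rewrite (ETD1_p0 scheme) (ETD1_n0 scheme).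
    by split; split=> //; apply: (periodic_bounded hN).
  rewrite (ETD1_p scheme) (ETD1_n scheme).
  (* One lemma serves both species, with potential [- phi k] for [p] and [phi k] for [n]. *)
  by split; apply: op_exp_L_h_bounded_nonneg => //; exact: ltW.
by move=> k; have [[_ pk] [_ nk]] := inv k.
Qed.
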